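(* Let $G$ be a finite group and suppose that for some integer $m$ we have $\widetilde H_{m}(\Delta\mathcal{S}G)=0$. Then there exists an injective homomorphism $$\widetilde H_{m}(\Delta\mathcal{C}G)\hookrightarrow \widetilde H_{m-1}(\Delta\mathcal{L}G)^{|G|}$$ and there exists a surjective homomorphism $$\widetilde H_{m+1}(\Delta\mathcal{C}G)\twoheadrightarrow \widetilde H_{m}(\Delta\mathcal{L}G)^{|G|}.$$
   Context: For a finite poset $P$, $\Delta P$ denotes its order complex (simplices are the nonempty finite chains of $P$). $\widetilde H_m$ is reduced integral homology, with the conventions $\widetilde H_{-1}(\emptyset)=\mathbb Z$, $\widetilde H_m(\emptyset)=0$ for $m\neq -1$, and $\widetilde H_m(X)=0$ for $m<0$ and $X\neq\emptyset$. For an abelian group $A$, $A^{|G|}$ is the direct sum of $|G|$ copies of $A$. For a finite group $G$ (all posets ordered by inclusion): $\mathcal{L}G=\{H\mid 1<H<G\}$ is the poset of nontrivial proper subgroups of $G$; $\mathcal{C}G=\{xH\mid H<G,\ x\in G\}$ is the poset of all left cosets of all proper subgroups of $G$ (the trivial subgroup included); $\mathcal{S}G$ is obtained from $\mathcal{C}G$ by removing the one-element cosets $\{g\}$, $g\in G$. *)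

(* Defs.v *)
From HB Require Import structures.
From mathcomp Require Import all_boot all_order all_fingroup all_algebra.
From mathcomp Require Import boolp ring.

Set Implicit Arguments.
Unset Strict Implicit.
Unset Printing Implicit Defensive.

Import Order.TTheory GRing.Theory Num.Theory.
Local Open Scope ring_scope.

Section OrderComplexHomology.

Context {d : Order.disp_t} {T : finPOrderType d}.
(* A finite poset is a subset P of T with the induced order. *)
Implicit Types (P s : {set T}) (m : int) (c : {ffun {set T} -> int}).

Definition order_complex P : {set {set T}} :=
  [set s in powerset P | (s != set0) && [forall x : T in s, forall y : T in s, (x >=< y)%O]].

(* The empty face, of dimension -1, is the generator of the augmentation term.
   There is no face of dimension m < -1. *)
Definition faces P m : {set {set T}} :=
  [set s in set0 |: order_complex P | #|s|%:Z == m + 1].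

(* A chain is an integral function on the sets of vertices; the m-chains are
   those that vanish off the m-dimensional faces. *)
Definition chains P m : {pred {ffun {set T} -> int}} :=
  [pred c : {ffun {set T} -> int} | [forall s, (c s != 0) ==> (s \in faces P m)]].

(* The usual boundary of x_0 < ... < x_m is the sum over i of (-1)^i times the
   face without x_i. The coefficient at s therefore collects the c (x |: s) with
   x outside s, where x has rank #|[set y in s | y < x]| in the chain x |: s. *)
Definition boundary c : {ffun {set T} -> int} :=
  [ffun s : {set T} => \sum_(x : T | x \notin s)
     (-1) ^+ #|[set y : T in s | (y < x)%O]| * c (x |: s)].

Lemma boundary_is_zmod_morphism : zmod_morphism boundary.
Proof.
move=> c1 c2; apply/ffunP=> s; rewrite !ffunE -sumrB.
by apply: eq_bigr => x _; rewrite !ffunE mulrBr.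
Qed.

HB.instance Definition _ :=
  GRing.isZmodMorphism.Build _ _ boundary boundary_is_zmod_morphism.

Fact chains_zmod_closed P m : zmod_closed (chains P m).
Proof.
split=> [|c1 c2]; rewrite !inE.
  by apply/forallP=> s; rewrite ffunE eqxx.
move=> /forallP c1P /forallP c2P; apply/forallP=> s; rewrite !ffunE.
apply/implyP; apply: contraR => sP.
have /negPn/eqP-> : ~~ (c1 s != 0) by apply: contra sP; apply/implyP.
have /negPn/eqP-> : ~~ (c2 s != 0) by apply: contra sP; apply/implyP.
by rewrite subr0.
Qed.

HB.instance Definition _ P m :=
  GRing.isZmodClosed.Build _ (chains P m) (chains_zmod_closed P m).

Lemma chains_comparable P m c s (x y : T) :
  c \in chains P m -> c s != 0 -> x \in s -> y \in s -> (x >=< y)%O.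
Proof.
rewrite inE => /forallP/(_ s)/implyP cP /cP; rewrite !inE => /andP[sP _] xs ys.
case/orP: sP => [/eqP s0|/and3P[_ _ /forallP/(_ x)]]; first by rewrite s0 inE in xs.
by rewrite xs => /forallP/(_ y); rewrite ys.
Qed.

Lemma boundary_boundary P m c : c \in chains P m -> boundary (boundary c) = 0.
Proof.
move=> cP; apply/ffunP=> s; rewrite !ffunE.
pose r (x : T) (u : {set T}) := #|[set z : T in u | (z < x)%O]|.
pose F x y : int :=
  (-1) ^+ r x s * ((-1) ^+ r y (x |: s) * c (y |: (x |: s))).
have rU (x y : T) : x \notin s -> r y (x |: s) = ((x < y)%O + r y s)%N.
  move=> xs; rewrite /r; case: (boolP (x < y)%O) => xy.
    rewrite (_ : [set z in x |: s | _] = x |: [set z : T in s | (z < y)%O]).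
      by rewrite cardsU1 inE (negPf xs).
    by apply/setP=> z; rewrite !inE; case: eqVneq => // ->; rewrite xy.
  congr #|pred_of_set _|; apply/setP=> z; rewrite !inE.
  by case: eqVneq => // ->; rewrite (negPf xy) (negPf xs).
have FN (x y : T) : x \notin s -> y \notin s -> x != y -> F x y = - F y x.
  move=> xs ys nxy; rewrite /F !rU // [x |: (y |: s)]setUCA.
  have [->|c_neq0] := eqVneq (c (y |: (x |: s))) 0; first by rewrite !mulr0 oppr0.
  have := chains_comparable (x := x) (y := y) cP c_neq0.
  rewrite !inE !eqxx orbT => /(_ isT isT).
  rewrite comparable_sym => /comparable_ltgtP[yx|xy|exy].
  - by rewrite add0n add1n exprS; ring.
  - by rewrite add0n add1n exprS; ring.
  by rewrite exy eqxx in nxy.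
transitivity (\sum_(x | x \notin s) \sum_(y | (y \notin s) && (x != y)) F x y).
  apply: eq_bigr => x xs; rewrite ffunE mulr_sumr.
  by apply: eq_bigl => y; rewrite !inE negb_or andbC eq_sym.
set S := (LHS in LHS = _).
have SN : S = - S.
  rewrite {1}/S (exchange_big_dep (fun y => y \notin s)) /=; last first.
    by move=> x y _ /andP[].
  rewrite -sumrN; apply: eq_bigr => x xs; rewrite -sumrN.
  apply: eq_big => y; first by rewrite xs eq_sym.
  by case/and3P=> ys _ nyx; apply: FN.
by apply/eqP; rewrite -[_ == 0](mulrn_eq0 S 2) mulr2n {2}SN subrr.
Qed.

Definition cycles P m : {pred {ffun {set T} -> int}} :=
  [pred c : {ffun {set T} -> int} | (c \in chains P m) && (boundary c == 0)].

Fact cycles_zmod_closed P m : zmod_closed (cycles P m).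
Proof.
split=> [|c1 c2].
  by apply/andP; split; [exact: (rpred0 (chains P m)) | rewrite raddf0].
case/andP=> c1P /eqP dc1 /andP[c2P /eqP dc2]; apply/andP; split.
  exact: (rpredB (S := chains P m)).
by apply/eqP; rewrite raddfB /= dc1 dc2 subrr.
Qed.

HB.instance Definition _ P m :=
  GRing.isZmodClosed.Build _ (cycles P m) (cycles_zmod_closed P m).

Definition cycle_module P m : Type := {c | c \in cycles P m}.

HB.instance Definition _ P m := SubChoice.on (cycle_module P m).
HB.instance Definition _ P m :=
  [SubChoice_isSubZmodule of cycle_module P m by <:].

Definition boundaries P m : {pred cycle_module P m} :=
  [pred z | `[< exists2 c, c \in chains P (m + 1) & boundary c = val z >]].

Arguments boundaries P m : clear implicits.

Fact boundaries_zmod_closed P m : zmod_closed (boundaries P m).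
Proof.
split=> [|z1 z2].
  by apply/asboolP; exists 0; rewrite ?raddf0 //; exact: (rpred0 (chains _ _)).
move=> /asboolP[c1 c1P dc1] /asboolP[c2 c2P dc2]; apply/asboolP.
exists (c1 - c2); first exact: (rpredB (S := chains _ _)).
by rewrite !raddfB /= dc1 dc2.
Qed.

HB.instance Definition _ P m :=
  GRing.isZmodClosed.Build _ (boundaries P m) (boundaries_zmod_closed P m).

(* Reduced integral homology, in degree m, of the order complex of P. *)
Definition reduced_homology P m : zmodType :=
  Quotient.quot (boundaries P m).

End OrderComplexHomology.

Arguments boundaries {d T} P m _.

(* Makes {set gT} a poset for inclusion. *)
Export Order.DefaultSetSubsetOrder.

Section GroupPosets.

Local Open Scope group_scope.

Context {gT : finGroupType}.
Implicit Type G : {group gT}.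

Definition subgroup_poset G : {set {set gT}} :=
  [set gval H | H : {group gT} & (1%G \proper H) && (H \proper G)].

Definition coset_poset G : {set {set gT}} :=
  [set x *: gval H | x in G, H in [pred H : {group gT} | H \proper G]].

Definition nonsingleton_coset_poset G : {set {set gT}} :=
  coset_poset G :\: [set [set g] | g in G].

End GroupPosets.

(* Main.v *)
Require Import Defs.
From HB Require Import structures.
From mathcomp Require Import all_boot all_order all_fingroup all_algebra.
From mathcomp Require Import boolp.

Set Implicit Arguments.
Unset Strict Implicit.
Unset Printing Implicit Defensive.

Import Order.TTheory GRing.Theory.
Local Open Scope ring_scope.

(** The singletons are the minimal elements of the coset poset C of a
    nontrivial group G, and removing them leaves the poset S of the other
    cosets. Hence a chain of cosets contains at most one singleton, at its
    bottom, and the quotient of the chain complexes of C and S is the direct sum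
    over g in G, in degrees shifted by one, of the augmented chain complexes of
    the links of the singletons {g}, that is, of the posets of the cosets
    strictly above {g}. These cosets are the g *: H with H a nontrivial proper
    subgroup, so left translation by g identifies the link with the subgroup
    poset L. The long exact sequence of the pair reads

      H_m(S) -> H_m(C) -> H_(m-1)(L)^|G| -> H_(m-1)(S),

    and when H_m(S) = 0 its middle map is injective in degree m, and surjective
    in degree m + 1.

    The two exactness statements are proved by hand, for any poset P and any
    family a of minimal points of P. The map to the links is induced by
    [link_part (a i)], which keeps the part of a chain whose faces contain a i,
    and strikes a i out of these faces. It has a section [joins] at the level of
    chains, which cones a family of chains of the links off the points a i. A
    chain of P all of whose link parts vanish is a chain of the poset Q without
    the a i. So lifting, by [joins], what is given in the links solves the
    problem at hand up to a cycle of Q, and this cycle bounds in Q since Q has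
    no homology in the degree considered. Correcting by the bounding chain gives
    both [bounds_of_links], hence injectivity, and [cycle_of_links], hence
    surjectivity.

    The trivial group is apart: its only singleton is not a proper coset. But
    then the three posets are empty, so the hypothesis makes the source of the
    first map and the target of the second one vanish. *)

(** * Chains, cycles and homology classes *)

Section Chains.

Context {d : Order.disp_t} {T : finPOrderType d}.
Implicit Types (P Q s : {set T}) (m n : int) (c : {ffun {set T} -> int}).

(** In this form the empty face needs no separate treatment: it is the chain
    with no vertex. *)
Lemma facesP P m s :
  reflect [/\ s \subset P, {in s &, forall x y : T, (x >=< y)%O}
            & #|s|%:Z = m + 1]
          (s \in faces P m).
Proof.
rewrite !inE; apply: (iffP andP) => [[sP /eqP sm]|[sP sC sm]].
  split=> //; first by case/orP: sP => [/eqP->|/andP[//]]; rewrite sub0set.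
  move=> x y xs ys; case/orP: sP => [/eqP s0|]; first by rewrite s0 inE in xs.
  by case/and3P=> _ _ /'forall_in_forall_inP; apply.
split; last exact/eqP.
case: eqVneq => //= _; rewrite sP; apply/'forall_in_forall_inP => x xs y ys.
exact: sC.
Qed.

Lemma chainsP P m c :
  reflect (forall s, c s != 0 -> s \in faces P m) (c \in chains P m).
Proof. by rewrite inE; apply: (iffP forallP) => H s; apply/implyP/H. Qed.

Lemma chains_eq0 P m c s : c \in chains P m -> s \notin faces P m -> c s = 0.
Proof. by move=> /chainsP/(_ s) cP; apply: contraNeq. Qed.

Lemma chains_sub P Q m c : P \subset Q -> c \in chains P m -> c \in chains Q m.
Proof.
move=> PQ /chainsP cP; apply/chainsP => s /cP /facesP[sP sC sm].
by apply/facesP; split=> //; apply: subset_trans PQ.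
Qed.

Lemma boundary_chains P m n c :
  m = n + 1 -> c \in chains P m -> boundary c \in chains P n.
Proof.
move=> -> /chainsP cP; apply/chainsP => s; rewrite ffunE => s_neq0.
have [x /andP[xs]] : exists x, (x \notin s) && (c (x |: s) != 0).
  apply/existsP; apply: contraNT s_neq0 => /existsPn c0.
  rewrite big1 // => x xs; have := c0 x; rewrite xs negbK => /eqP->.
  by rewrite mulr0.
move=> /cP /facesP[]; rewrite subUset cardsU1 xs => /andP[_ sP] sC sm.
apply/facesP; split=> //.
  by move=> y z ys zs; apply: sC; rewrite inE ?ys ?zs orbT.
by apply: (addrI 1); rewrite -PoszD sm addrC.
Qed.

Lemma cyclesP P m c :
  reflect (c \in chains P m /\ boundary c = 0) (c \in cycles P m).
Proof. by rewrite [_ \in cycles _ _]inE; apply: (iffP andP) => -[? /eqP]. Qed.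

Definition bounds P m c := exists2 b, b \in chains P (m + 1) & boundary b = c.

Lemma bounds_cycles P m c : bounds P m c -> c \in cycles P m.
Proof.
case=> b bP <-; apply/cyclesP; split; first exact: boundary_chains bP.
exact: boundary_boundary bP.
Qed.

(** The class of a plain function, so that no proof of being a cycle is carried
    along; functions that are not cycles get the junk value 0. *)
Definition homology_class P m c : reduced_homology P m :=
  \pi_(reduced_homology P m)%qT (insubd (0 : cycle_module P m) c).

Lemma homology_class_eq0 P m c : c \in cycles P m ->
  homology_class P m c = 0 <-> bounds P m c.
Proof.
move=> cP.
have -> : (homology_class P m c = 0) <->
          insubd (0 : cycle_module P m) c \in boundaries P m.
  rewrite -[X in X \in _]subr0 Quotient.idealrBE /homology_class.
  by rewrite raddf0; split=> [->|/eqP].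
rewrite inE; split=> [/asboolP|] H; last apply/asboolP.
  by case: H => b bP db; exists b; rewrite // db insubdK.
by case: H => b bP db; exists b; rewrite // db insubdK.
Qed.

Lemma homology_classB P m c1 c2 : c1 \in cycles P m -> c2 \in cycles P m ->
  homology_class P m (c1 - c2) = homology_class P m c1 - homology_class P m c2.
Proof.
move=> c1P c2P; rewrite /homology_class -raddfB; congr (_ _).
apply: val_inj; rewrite raddfB /= !insubdK //.
exact: (rpredB (S := cycles P m)).
Qed.

Lemma homology_class_surj P m (h : reduced_homology P m) :
  exists2 c, c \in cycles P m & homology_class P m c = h.
Proof.
exists (val (generic_quotient.repr h)); first exact: valP.
by rewrite /homology_class valKd reprK.
Qed.

Lemma acyclic_bounds P m : (forall h : reduced_homology P m, h = 0) ->
  forall c, c \in cycles P m -> bounds P m c.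
Proof. by move=> P0 c cP; apply/homology_class_eq0. Qed.

End Chains.

(** A finite family of maps that preserve cycles and boundaries passes to
    homology. It is stated for such maps rather than for chain maps because
    taking the link part anticommutes with the boundary. *)
Lemma induced_homology_map (d d' : Order.disp_t) (T : finPOrderType d)
    (T' : finPOrderType d') (I : finType) (P : {set T}) (Q : {set T'})
    (m n : int)
    (k : I -> {additive {ffun {set T} -> int} -> {ffun {set T'} -> int}}) :
    (forall i c, c \in cycles P m -> k i c \in cycles Q n) ->
    (forall i c, bounds P m c -> bounds Q n (k i c)) ->
  exists F : {additive reduced_homology P m ->
                       {ffun I -> reduced_homology Q n}},
    forall c, c \in cycles P m ->
      F (homology_class P m c) = [ffun i => homology_class Q n (k i c)].
Proof.
move=> kZ kB.
pose F (h : reduced_homology P m) : {ffun I -> reduced_homology Q n} :=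
  [ffun i => homology_class Q n (k i (val (generic_quotient.repr h)))].
have FE c : c \in cycles P m ->
    F (homology_class P m c) = [ffun i => homology_class Q n (k i c)].
  move=> cP; apply/ffunP=> i; rewrite !ffunE.
  set h := homology_class P m c; have rP := valP (generic_quotient.repr h).
  apply/eqP; rewrite -subr_eq0 -homology_classB ?kZ // -raddfB; apply/eqP.
  apply/homology_class_eq0; first by apply/kZ/(rpredB (S := cycles P m)).
  apply/kB/homology_class_eq0; first exact: (rpredB (S := cycles P m)).
  by rewrite homology_classB // {1}/homology_class valKd reprK subrr.
have FB : zmod_morphism F.
  move=> h1 h2; have [c1 c1P <-] := homology_class_surj h1.
  have [c2 c2P <-] := homology_class_surj h2.
  rewrite -homology_classB // !FE //; last exact: (rpredB (S := cycles P m)).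
  by apply/ffunP=> i; rewrite !ffunE raddfB homology_classB ?kZ.
pose FA : {additive reduced_homology P m -> {ffun I -> reduced_homology Q n}} :=
  HB.pack F (GRing.isZmodMorphism.Build _ _ F FB).
by exists FA.
Qed.

(** * Transport along order embeddings *)

Section Embeddings.

Context {d d' : Order.disp_t} {T : finPOrderType d} {T' : finPOrderType d'}.
Variable f : T' -> T.
Hypothesis f_le : {mono f : x y / (x <= y)%O}.
Implicit Types (L s : {set T'}) (m : int) (c : {ffun {set T} -> int}).

Definition pullback c : {ffun {set T'} -> int} :=
  [ffun s : {set T'} => c (f @: s)].

Lemma pullback_is_zmod_morphism : zmod_morphism pullback.
Proof. by move=> c1 c2; apply/ffunP=> s; rewrite !ffunE. Qed.

HB.instance Definition _ :=
  GRing.isZmodMorphism.Build _ _ pullback pullback_is_zmod_morphism.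

Lemma embedding_inj : injective f.
Proof. exact: inc_inj f_le. Qed.

Lemma imset_faces L m s : (f @: s \in faces (f @: L) m) = (s \in faces L m).
Proof.
have f_inj := embedding_inj; have f_cmp x y : (f x >=< f y)%O = (x >=< y)%O.
  by rewrite /Order.comparable !f_le.
apply/facesP/facesP; rewrite card_imset // => -[sL sC sm]; split=> //.
- by apply/subsetP=> x xs; rewrite -(mem_imset _ _ f_inj) (subsetP sL) ?imset_f.
- by move=> x y xs ys; rewrite -f_cmp sC ?imset_f.
- exact: imsetS.
by move=> _ _ /imsetP[x xs ->] /imsetP[y ys ->]; rewrite f_cmp sC.
Qed.

Lemma pullback_chains L m c :
  c \in chains (f @: L) m -> pullback c \in chains L m.
Proof.
by move/chainsP=> cL; apply/chainsP=> s; rewrite ffunE -imset_faces => /cL.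
Qed.

(** Pulling back commutes with the boundary only for chains of the image: the
    boundary of c at f @: s also involves the points outside the range of f,
    whose contribution vanishes when c is supported on the image. *)
Lemma boundary_pullback L m c :
  c \in chains (f @: L) m -> boundary (pullback c) = pullback (boundary c).
Proof.
move=> cL; have f_inj := embedding_inj; apply/ffunP=> s; rewrite !ffunE.
rewrite [RHS](bigID (mem (codom f))) /= [X in _ + X]big1 ?addr0; last first.
  move=> y /andP[_ yf]; rewrite (chains_eq0 cL) ?mulr0 //.
  apply: contra yf => /facesP[]; rewrite subUset sub1set => /andP[yL _] _ _.
  by case/imsetP: yL => x _ ->; apply: codom_f.
transitivity (\sum_(y in f @: ~: s)
    (-1) ^+ #|[set z in f @: s | (z < y)%O]| * c (y |: f @: s)).
  rewrite big_imset /=; last exact: in2W.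
  apply: eq_big => [x|x _]; first by rewrite !inE.
  rewrite ffunE imsetU1; congr (_ ^+ _ * _).
  rewrite -(card_imset _ f_inj); apply/eq_card=> z; rewrite !inE.
  apply/imsetP/andP => [[y]|[/imsetP[y ys ->]]].
    by rewrite inE => /andP[ys yx] ->; rewrite imset_f ?leW_mono.
  by rewrite leW_mono // => yx; exists y; rewrite ?inE ?ys.
apply: eq_bigl => y; apply/imsetP/andP=> [[x]|[ys /codomP[x yx]]].
  by rewrite inE => xs ->; rewrite mem_imset ?codom_f.
by exists x; rewrite // inE -(mem_imset _ _ f_inj) -yx.
Qed.

Lemma pullback_eq0 L m c : c \in chains (f @: L) m -> pullback c = 0 -> c = 0.
Proof.
move=> cL /ffunP c0; apply/ffunP=> s; rewrite ffunE.
have [/facesP[/subsetP sL _ _]|/(chains_eq0 cL) //] :=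
  boolP (s \in faces (f @: L) m).
have <- : f @: (f @^-1: s) = s.
  apply/setP=> y; apply/imsetP/idP => [[x + ->]|ys]; first by rewrite inE.
  by have /imsetP[x _ yx] := sL _ ys; exists x; rewrite // inE -yx.
by have := c0 (f @^-1: s); rewrite !ffunE.
Qed.

Lemma pullback_surj L m (c' : {ffun {set T'} -> int}) : c' \in chains L m ->
  exists2 c, c \in chains (f @: L) m & pullback c = c'.
Proof.
move=> c'L; have f_inj := embedding_inj.
have fK s : f @^-1: (f @: s) = s.
  by apply/setP=> x; rewrite inE mem_imset.
exists [ffun s : {set T} =>
          if s \in faces (f @: L) m then c' (f @^-1: s) else 0].
  by apply/chainsP=> s; rewrite ffunE; case: ifP => //; rewrite eqxx.
apply/ffunP=> s; rewrite !ffunE imset_faces fK.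
by case: ifPn => // /(chains_eq0 c'L) ->.
Qed.

Lemma pullback_cycles L m c :
  c \in cycles (f @: L) m -> pullback c \in cycles L m.
Proof.
case/cyclesP=> cL dc; apply/cyclesP; split; first exact: pullback_chains.
by rewrite (boundary_pullback cL) dc raddf0.
Qed.

Lemma pullback_bounds L m c : c \in chains (f @: L) m ->
  bounds L m (pullback c) <-> bounds (f @: L) m c.
Proof.
move=> cL; split=> [[b' /pullback_surj[b bL <-] db]|[b bL db]]; last first.
  exists (pullback b); first exact: pullback_chains.
  by rewrite (boundary_pullback bL) db.
exists b => //; apply/eqP; rewrite -subr_eq0; apply/eqP.
apply: (@pullback_eq0 L m).
  by apply: (rpredB (S := chains (f @: L) m)) => //; apply: boundary_chains bL.
by rewrite raddfB /= -(boundary_pullback bL) db subrr.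
Qed.

Lemma pullback_cycles_surj L m (c' : {ffun {set T'} -> int}) :
  c' \in cycles L m -> exists2 c, c \in cycles (f @: L) m & pullback c = c'.
Proof.
case/cyclesP=> /pullback_surj[c cL <-] dc; exists c => //; apply/cyclesP.
split=> //; apply: (@pullback_eq0 L (m - 1)).
  by apply: boundary_chains cL; rewrite subrK.
by rewrite -(boundary_pullback cL).
Qed.

End Embeddings.

(** * The link of a minimal point *)

Section Links.

Context {d : Order.disp_t} {T : finPOrderType d}.
Implicit Types (P s : {set T}) (m : int) (c : {ffun {set T} -> int}) (a : T).

Definition upper_link P a : {set T} := [set x in P | (a < x)%O].

Definition link_part a c : {ffun {set T} -> int} :=
  [ffun s : {set T} => if a \in s then 0 else c (a |: s)].

Lemma link_part_is_zmod_morphism a : zmod_morphism (link_part a).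
Proof.
move=> c1 c2; apply/ffunP=> s; rewrite !ffunE.
by case: ifP => _ //; rewrite subr0.
Qed.

HB.instance Definition _ a :=
  GRing.isZmodMorphism.Build _ _ (link_part a) (link_part_is_zmod_morphism a).

(** A chain through a minimal point has that point as its least element, which
    is why the link of a minimal point only consists of points above it. *)
Lemma face_above_minimal P m a s :
    {in P, forall x, (x <= a)%O -> x = a} -> a \notin s ->
  a |: s \in faces P m -> s \in faces (upper_link P a) (m - 1).
Proof.
move=> a_min as_; rewrite -[m in faces P m](subrK 1).
case/facesP; rewrite subUset => /andP[_ /subsetP sP] sC sm.
apply/facesP; split.
- apply/subsetP=> x xs; rewrite inE sP //= lt_neqAle.
  have xa : x != a by apply: contraNneq as_ => <-.
  rewrite eq_sym xa; have := sC a x; rewrite !inE eqxx xs orbT => /(_ isT isT).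
  by case/orP=> // /(a_min _ (sP _ xs)) /eqP; rewrite (negPf xa).
- by move=> x y xs ys; apply: sC; rewrite inE ?xs ?ys orbT.
by move: sm; rewrite cardsU1 as_ PoszD addrC => /addIr.
Qed.

Lemma link_part_chains P m a c : {in P, forall x, (x <= a)%O -> x = a} ->
  c \in chains P m -> link_part a c \in chains (upper_link P a) (m - 1).
Proof.
move=> a_min /chainsP cP; apply/chainsP=> s; rewrite ffunE.
by case: ifPn => [|as_ /cP]; [rewrite eqxx | apply: face_above_minimal].
Qed.

(** Since a is below all the other vertices, inserting it shifts their ranks by
    one, which accounts for the sign. *)
Lemma boundary_link_part P m a c : {in P, forall x, (x <= a)%O -> x = a} ->
  c \in chains P m -> boundary (link_part a c) = - link_part a (boundary c).
Proof.
move=> a_min cP; apply/ffunP=> s; rewrite !ffunE.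
have [as_|as_] := boolP (a \in s).
  by rewrite oppr0 big1 // => x _; rewrite ffunE inE as_ orbT mulr0.
(* On the left a is not in s either, but link_part vanishes on a |: s. *)
rewrite (bigD1 a) //= ffunE setU11 mulr0 add0r -sumrN.
apply: eq_big => x; first by rewrite !inE negb_or andbC.
case/andP=> xs xa; rewrite ffunE !inE eq_sym (negPf xa) (negPf as_) setUCA.
have [->|c_neq0] := eqVneq (c (x |: (a |: s))) 0; first by rewrite !mulr0 oppr0.
have ax : (a < x)%O.
  move/chainsP/(_ _ c_neq0): cP; rewrite setUCA => /(face_above_minimal a_min).
  rewrite in_setU1 eq_sym (negPf xa) (negPf as_) => /(_ isT).
  case/facesP=> /subsetP sL _ _.
  by have := sL x; rewrite !inE eqxx => /(_ isT) /andP[].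
have -> : [set y in a |: s | (y < x)%O] = a |: [set y in s | (y < x)%O].
  by apply/setP=> y; rewrite !inE; case: eqVneq => // ->; rewrite ax.
by rewrite cardsU1 inE (negPf as_) exprS mulN1r mulNr opprK.
Qed.

Lemma link_part_cycles P m a c : {in P, forall x, (x <= a)%O -> x = a} ->
  c \in cycles P m -> link_part a c \in cycles (upper_link P a) (m - 1).
Proof.
move=> a_min /cyclesP[cP dc]; apply/cyclesP.
split; first exact: link_part_chains.
by rewrite (boundary_link_part a_min cP) dc raddf0 oppr0.
Qed.

Lemma link_part_bounds P m a c : {in P, forall x, (x <= a)%O -> x = a} ->
  bounds P m c -> bounds (upper_link P a) (m - 1) (link_part a c).
Proof.
move=> a_min [b bP <-]; exists (- link_part a b).
  rewrite (rpredN (chains (upper_link P a) (m - 1 + 1))) addrAC.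
  exact: link_part_chains.
by rewrite raddfN /= (boundary_link_part a_min bP) opprK.
Qed.

Lemma link_part_off P m a c :
  a \notin P -> c \in chains P m -> link_part a c = 0.
Proof.
move=> aP /chains_eq0 c0; apply/ffunP=> s; rewrite !ffunE; case: ifP => // _.
by apply: c0; apply: contra aP => /facesP[]; rewrite subUset sub1set => /andP[].
Qed.

End Links.

(** * Exactness for the removal of minimal points *)

Section RemovingMinimalPoints.

Context {d : Order.disp_t} {T : finPOrderType d} (I : finType).
Variables (P : {set T}) (a : I -> T).
Hypothesis aP : forall i, a i \in P.
Hypothesis a_min : forall i, {in P, forall x, (x <= a i)%O -> x = a i}.
Hypothesis a_inj : injective a.
Implicit Types (s : {set T}) (m : int) (c : {ffun {set T} -> int}).
Implicit Type b : I -> {ffun {set T} -> int}.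

Let Q : {set T} := P :\: [set a i | i : I].

(** The sum of the cones with apex a i over the b i. *)
Definition joins b : {ffun {set T} -> int} :=
  [ffun s : {set T} => \sum_(i | a i \in s) b i (s :\ a i)].

Lemma joins_chains m b :
    (forall i, b i \in chains (upper_link P (a i)) m) ->
  joins b \in chains P (m + 1).
Proof.
move=> bP; apply/chainsP=> s; rewrite ffunE => s_neq0.
have [i /andP[ais]] : exists i, (a i \in s) && (b i (s :\ a i) != 0).
  apply/existsP; apply: contraNT s_neq0 => /existsPn b0.
  by rewrite big1 // => i ais; have := b0 i; rewrite ais negbK => /eqP.
move: (bP i) => /chainsP/[apply]/facesP[/subsetP sL sC sm].
have sE x : x \in s -> x = a i \/ x \in s :\ a i.
  by move=> xs; rewrite !inE xs andbT; case: eqVneq; [left | right].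
have aix x : x \in s :\ a i -> (a i >=< x)%O.
  by move=> /sL; rewrite inE => /andP[_ /ltW]; rewrite /Order.comparable => ->.
apply/facesP; split.
- apply/subsetP=> x /sE[-> //|/sL]; by rewrite inE => /andP[].
- move=> x y /sE[->|xs] /sE[->|ys]; last exact: sC.
  + exact: comparablexx.
  + exact: aix.
  by rewrite comparable_sym; apply: aix.
by rewrite (cardsD1 (a i)) ais PoszD sm addrC.
Qed.

(** Only the cone with apex a i contributes at a face through a i, because a i,
    being minimal, lies in the link of no other a j. *)
Lemma link_part_joins m b i :
    (forall i, b i \in chains (upper_link P (a i)) m) ->
  link_part (a i) (joins b) = b i.
Proof.
move=> bP; apply/ffunP=> s; rewrite !ffunE; case: ifPn => [ais|ais].
  rewrite (chains_eq0 (bP i)) //; apply/negP=> /facesP[/subsetP/(_ _ ais)].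
  by rewrite inE ltxx andbF.
rewrite (bigD1 i) ?setU11 //= setU1K // big1 ?addr0 // => j /andP[_ ji].
rewrite (chains_eq0 (bP j)) //; apply/negP=> /facesP[/subsetP/(_ (a i)) + _ _].
rewrite !inE eqxx (inj_eq a_inj) eq_sym ji => /(_ isT) /andP[_ aji].
by move/eqP: ji; apply; apply: a_inj; apply: a_min; rewrite ?ltW.
Qed.

Lemma chains_without_links m c : c \in chains P m ->
  (forall i, link_part (a i) c = 0) -> c \in chains Q m.
Proof.
move=> /chainsP cP c0; apply/chainsP=> s c_neq0.
have /facesP[sP sC sm] := cP _ c_neq0; apply/facesP; split=> //.
rewrite subsetD sP; apply/pred0P=> x /=; apply: contraNF c_neq0.
case/andP=> xs /imsetP[i _ xi]; move/ffunP/(_ (s :\ x)): (c0 i).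
by rewrite !ffunE -xi setD1K // !inE eqxx => /= ->.
Qed.

Lemma link_part_without_links m c i : c \in chains Q m -> link_part (a i) c = 0.
Proof. by apply: link_part_off; rewrite inE imset_f. Qed.

(** If b i bounds the link part of c at a i, then adding the boundary of
    [joins b] to c cancels every link part, by the sign in
    [boundary_link_part], and leaves a cycle of Q. *)
Lemma bounds_of_links m c :
    (forall c', c' \in cycles Q m -> bounds Q m c') -> c \in cycles P m ->
    (forall i, bounds (upper_link P (a i)) (m - 1) (link_part (a i) c)) ->
  bounds P m c.
Proof.
move=> Q0 /cyclesP[cP dc] cB.
have {cB} [b bP db] : exists2 b, forall i, b i \in chains (upper_link P (a i)) m
    & forall i, boundary (b i) = link_part (a i) c.
  apply: (@fin_all_exists2 _ _
    (fun i u => u \in chains (upper_link P (a i)) m)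
    (fun i u => boundary u = link_part (a i) c)) => i.
  by have [b] := cB i; rewrite subrK; exists b.
have wP := joins_chains bP; set w := joins b in wP.
have [|u uQ du] := Q0 (c + boundary w).
  apply/cyclesP; split; last first.
    by rewrite raddfD /= dc (boundary_boundary wP) addr0.
  apply: chains_without_links => [|i].
    by apply: (rpredD (S := chains P m)) => //; apply: boundary_chains wP.
  rewrite raddfD /= -[link_part _ (boundary _)]opprK.
  rewrite -(boundary_link_part (@a_min i) wP).
  by rewrite (link_part_joins _ bP) db subrr.
exists (u - w); last by rewrite raddfB /= du addrK.
apply: (rpredB (S := chains P (m + 1))) => //.
by apply: chains_sub uQ; apply: subsetDl.
Qed.

(** The boundary of [joins b] has no link part, so it is a cycle of Q; it is
    also the boundary of a chain u of Q, and [joins b - u] is the required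
    cycle, as u has no link part. *)
Lemma cycle_of_links m b :
    (forall c', c' \in cycles Q m -> bounds Q m c') ->
    (forall i, b i \in cycles (upper_link P (a i)) m) ->
  exists2 c, c \in cycles P (m + 1) & forall i, link_part (a i) c = b i.
Proof.
move=> Q0 bZ; have bP i : b i \in chains (upper_link P (a i)) m.
  by have /cyclesP[] := bZ i.
have wP := joins_chains bP; set w := joins b in wP.
have [|u uQ du] := Q0 (boundary w).
  apply/cyclesP; split; last exact: boundary_boundary wP.
  apply: chains_without_links => [|i]; first exact: boundary_chains wP.
  apply: oppr_inj; rewrite -(boundary_link_part (@a_min i) wP).
  by rewrite (link_part_joins _ bP) oppr0; have /cyclesP[] := bZ i.
exists (w - u) => [|i]; last first.
  rewrite raddfB /= (link_part_joins _ bP).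
  by rewrite (link_part_without_links _ uQ) subr0.
apply/cyclesP; split; last by rewrite raddfB /= du subrr.
apply: (rpredB (S := chains P (m + 1))) => //.
by apply: chains_sub uQ; apply: subsetDl.
Qed.

Context {d' : Order.disp_t} {T' : finPOrderType d'}.
Variables (L : {set T'}) (f : I -> T' -> T).
Hypothesis f_le : forall i, {mono f i : x y / (x <= y)%O}.
Hypothesis f_link : forall i, f i @: L = upper_link P (a i).

Let k i := pullback (f i) \o link_part (a i).

(** The target degree is a variable n so that the map can be used both from
    degree m to m - 1 and from degree m + 1 to m without casts. *)
Lemma links_homology_map m n : m - 1 = n ->
  exists F : {additive reduced_homology P m ->
                       {ffun I -> reduced_homology L n}},
    forall c, c \in cycles P m ->
      F (homology_class P m c) = [ffun i => homology_class L n (k i c)].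
Proof.
move=> <-; apply: induced_homology_map => i c.
  by move/(link_part_cycles (@a_min i)); rewrite -f_link; apply: pullback_cycles.
move=> cB; apply/(pullback_bounds (f_le i)); rewrite f_link.
  by apply: link_part_chains => //; have /cyclesP[] := bounds_cycles cB.
exact: link_part_bounds.
Qed.

Lemma links_homology_map_inj m : (forall h : reduced_homology Q m, h = 0) ->
  exists F : {additive reduced_homology P m ->
                       {ffun I -> reduced_homology L (m - 1)}}, injective F.
Proof.
move=> /acyclic_bounds Q0; have [F FE] := links_homology_map (erefl (m - 1)).
exists F; apply: raddf_inj => h; have [c cP <-] := homology_class_surj h.
rewrite FE // => /ffunP F0; apply/homology_class_eq0 => //.
apply: bounds_of_links => // i; rewrite -f_link.
have cL : link_part (a i) c \in cycles (f i @: L) (m - 1).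
  by rewrite f_link; apply: link_part_cycles.
have /cyclesP[cL' _] := cL; apply/(pullback_bounds (f_le i) cL').
have := F0 i; rewrite !ffunE => /homology_class_eq0.
by apply; apply: pullback_cycles.
Qed.

Lemma links_homology_map_surj m : (forall h : reduced_homology Q m, h = 0) ->
  exists F : {additive reduced_homology P (m + 1) ->
                       {ffun I -> reduced_homology L m}},
    forall y, exists x, F x = y.
Proof.
move=> /acyclic_bounds Q0; have [F FE] := links_homology_map (addrK 1 m).
exists F => y.
have [b bZ bE] : exists2 b, forall i, b i \in cycles (upper_link P (a i)) m
    & forall i, homology_class L m (pullback (f i) (b i)) = y i.
  apply: (@fin_all_exists2 _ _
    (fun i u => u \in cycles (upper_link P (a i)) m)
    (fun i u => homology_class L m (pullback (f i) u) = y i)) => i.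
  have [c' /(pullback_cycles_surj (f_le i))[c cL <-] <-] :=
    homology_class_surj (y i).
  by exists c; rewrite -?f_link.
have [c cP cE] := cycle_of_links Q0 bZ.
exists (homology_class P (m + 1) c); rewrite FE //.
by apply/ffunP=> i; rewrite ffunE /k /= cE.
Qed.

End RemovingMinimalPoints.

(** * The coset poset of a finite group *)

Section CosetPosets.

Local Open Scope group_scope.

Context {gT : finGroupType}.
Implicit Types (G H : {group gT}) (A B : {set gT}).

Lemma le_subset A B : (A <= B)%O = (A \subset B).
Proof. by []. Qed.

Lemma lt_proper A B : (A < B)%O = (A \proper B).
Proof. by rewrite lt_leAnge properE. Qed.

Lemma coset_posetP G A :
  reflect (exists2 x, x \in G & exists2 H : {group gT}, H \proper G & A = x *: H)
          (A \in coset_poset G).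
Proof.
apply: (iffP imset2P) => [[x H xG HG ->]|[x xG [H HG ->]]].
  by exists x => //; exists H.
by exists x H.
Qed.

Lemma lcoset_mono (g : gT) : {mono *%g [set g] : A B / (A <= B)%O}.
Proof. by move=> A B; rewrite !le_subset lcosetS. Qed.

(** A coset that contains g is g *: H for a subgroup H, and it is different from
    {g} = g *: 1 exactly when H is nontrivial. *)
Lemma lcoset_subgroup_poset G (g : gT) : g \in G ->
  *%g [set g] @: subgroup_poset G = upper_link (coset_poset G) [set g].
Proof.
move=> gG; apply/setP=> A; rewrite inE lt_proper.
apply/imsetP/andP => [[_ /imsetP[H + ->] ->]|[]].
  rewrite inE => /andP[H1 HG].
  split; first by apply/coset_posetP; exists g => //; exists H.
  by rewrite -{1}[[set g]]mulg1 properE !lcosetS -properE.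
case/coset_posetP=> x xG [H HG ->]; rewrite properE sub1set => /andP[gxH].
have <- : g *: H = x *: H by apply/esym/lcoset_eqP; rewrite lcoset_sym.
rewrite -{2}[[set g]]mulg1 lcosetS => H1.
by exists (gval H) => //; apply: imset_f; rewrite inE properE sub1G H1.
Qed.

Lemma singleton_minimal G (g : gT) :
  {in coset_poset G, forall A, (A <= [set g])%O -> A = [set g]}.
Proof.
move=> A /coset_posetP[x _ [H _ ->]]; rewrite le_subset subset1.
case/orP=> /eqP // xH0; have := lcoset_refl H x; by rewrite xH0 inE.
Qed.

(** For trivial G, the singleton is the coset of the whole group, which is not
    proper. *)
Lemma singleton_coset G (g : gT) :
  1%G \proper G -> g \in G -> [set g] \in coset_poset G.
Proof.
move=> G1 gG; apply/coset_posetP; exists g => //; exists 1%G => //.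
by rewrite -[RHS]/([set g] * 1) mulg1.
Qed.

Lemma coset_posets_trivial G : ~~ (1%G \proper G) ->
  [/\ coset_poset G = set0, nonsingleton_coset_poset G = set0
    & subgroup_poset G = set0].
Proof.
rewrite properE sub1G negbK => G1.
have no_proper H : (H \proper G) = false.
  apply: contraTF G1 => /properP[_ [x xG xH]].
  by apply: contra xH => /subsetP/(_ _ xG)/set1P->.
have C0 : coset_poset G = set0.
  apply/setP=> A; rewrite inE; apply/coset_posetP=> -[x _ [H]].
  by rewrite no_proper.
split=> //; first by rewrite /nonsingleton_coset_poset C0 set0D.
by apply/setP=> A; rewrite inE; apply/imsetP=> -[H]; rewrite inE no_proper andbF.
Qed.

End CosetPosets.

Theorem theorem6p3 (gT : finGroupType) (G : {group gT}) (m : int) :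
  (forall h : reduced_homology (nonsingleton_coset_poset G) m, h = 0) ->
  (exists f : {additive reduced_homology (coset_poset G) m ->
                 {ffun 'I_#|G| -> reduced_homology (subgroup_poset G) (m - 1)}},
     injective f) /\
  (exists f : {additive reduced_homology (coset_poset G) (m + 1) ->
                 {ffun 'I_#|G| -> reduced_homology (subgroup_poset G) m}},
     forall y, exists x, f x = y).
Proof.
have [G1|/coset_posets_trivial[-> -> ->] h0] := boolP (1%G \proper G); last first.
  split; exists \0; first by move=> h1 h2 _; rewrite [h1]h0 [h2]h0.
  by move=> y; exists 0; apply/ffunP=> i; rewrite [y i]h0 ffunE.
pose a (i : 'I_#|G|) := [set enum_val i].
have aG i : enum_val i \in G := enum_valP i.
have aP i : a i \in coset_poset G by apply: singleton_coset.
have a_inj : injective a by move=> i j /set1_inj/enum_val_inj.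
have a_min i : {in coset_poset G, forall A, (A <= a i)%O -> A = a i}.
  exact: singleton_minimal.
have -> : nonsingleton_coset_poset G = coset_poset G :\: [set a i | i : 'I_#|G|].
  congr (_ :\: _); apply/setP=> A; apply/imsetP/imsetP=> -[x xG ->].
    by exists (enum_rank_in xG x); rewrite // /a enum_rankK_in.
  by exists (enum_val x).
move=> h0; have f_link (i : 'I_#|G|) := lcoset_subgroup_poset (aG i).
have f_le (i : 'I_#|G|) := lcoset_mono (enum_val i).
split; first exact: (links_homology_map_inj aP a_min a_inj f_le f_link h0).
exact: (links_homology_map_surj aP a_min a_inj f_le f_link h0).
Qed.
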